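(* Let $f:[a,b]\to\mathbb{R}$ be $L$-Lipschitzian on $[a,b]$, and let $S=\frac{f(b)-f(a)}{b-a}$. Then for all $h\in[0,1]$ and all $x$ with $a+h\frac{b-a}{2}\le x\le b-h\frac{b-a}{2}$, $$\left|(b-a)\left[f(x)(1-h)+\frac{f(a)+f(b)}{2}h\right]-\int_a^b f(t)\,dt\right|\le \left[\frac{(b-a)^2}{4}\left[h^2+(h-1)^2\right]+\left(x-\frac{a+b}{2}\right)^2\right]L,$$ and $$\left|(b-a)\left\{\left[f(x)+L\left(x-\frac{a+b}{2}\right)\right](1-h)+\frac{f(a)+f(b)}{2}h\right\}-\int_a^b f(t)\,dt\right|\le (b-a)\max\left\{h\frac{b-a}{2},\,x-a-h\frac{b-a}{2},\,b-x-h\frac{b-a}{2}\right\}(S+L).$$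
   Context: Here $a<b$ are real numbers. A function $f:[a,b]\to\mathbb{R}$ is said to be $L$-Lipschitzian on $[a,b]$, where $L>0$, if $|f(x)-f(y)|\le L|x-y|$ for all $x,y\in[a,b]$. *)

(* Defs.v *)
From Stdlib Require Import Reals.
From Coquelicot Require Import Coquelicot.
Open Scope R_scope.

(* A function on [a, b] is represented by a function on R of which only the
   values on [a, b] are constrained; [RInt f a b] does not depend on the
   others. *)
Definition lipschitzian_on (L : R) (f : R -> R) (a b : R) : Prop :=
  0 < L /\
  forall x y : R, a <= x <= b -> a <= y <= b ->
    Rabs (f x - f y) <= L * Rabs (x - y).

(* Main.v *)
Require Import Defs.
From Stdlib Require Import Reals Lra.
From Coquelicot Require Import Coquelicot.
Open Scope R_scope.

(** With [u = a + h (b - a) / 2] and [v = b - h (b - a) / 2], the quadrature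
    rule is the integral of the step function equal to [f a] on [a, u], [f x]
    on [u, v] and [f b] on [v, b].  The first bound adds up the errors on
    [a, u], [u, x], [x, v] and [v, b], where the rule uses the value of [f] at
    an endpoint, so each error is at most [L] times half the squared length.
    The second bound replaces [f] by the nondecreasing function
    [f t + L (t - (a + b) / 2)], which has the same integral and the same sum
    of endpoint values: each error is at most the length times the increment
    of that function, and the increments add up to [(b - a) (S + L)]. *)

(** The affine functions serve as the lines of slope [L] or [- L] through an endpoint value that
    enclose a Lipschitzian function; [z] is that endpoint. *)
Lemma is_RInt_affine (c k z p q : R) :
  is_RInt (fun t => c + k * (t - z)) p q
    (c * (q - p) + k * ((q - z) ^ 2 - (p - z) ^ 2) / 2).
Proof.
  pose (P := fun t => c * t + k * (t - z) ^ 2 / 2).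
  replace (c * (q - p) + k * ((q - z) ^ 2 - (p - z) ^ 2) / 2)
    with (minus (P q) (P p))
    by (unfold P, minus, plus, opp; simpl; field).
  apply (is_RInt_derive P).
  - intros t _. unfold P. auto_derive; [trivial | field].
  - intros t _. apply (ex_derive_continuous (fun t => c + k * (t - z))).
    auto_derive; trivial.
Qed.

Lemma lipschitzian_on_sub (L : R) (f : R -> R) (a b p q : R) :
  a <= p -> q <= b -> lipschitzian_on L f a b -> lipschitzian_on L f p q.
Proof.
  intros Hp Hq [HL Hf]. split; [exact HL |].
  intros s t Hs Ht. apply Hf; lra.
Qed.

Lemma clamp_bounds (p q t : R) : p <= q -> p <= Rmax p (Rmin q t) <= q.
Proof.
  intros Hpq. split; [apply Rmax_l |].
  apply Rmax_lub; [exact Hpq | apply Rmin_l].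
Qed.

Lemma clamp_nonexpansive (p q s t : R) :
  Rabs (Rmax p (Rmin q s) - Rmax p (Rmin q t)) <= Rabs (s - t).
Proof.
  unfold Rmax, Rmin, Rabs.
  repeat first [destruct Rle_dec | destruct Rcase_abs]; lra.
Qed.

(* [f] need not be continuous at the endpoints as a function on [R], hence the
   continuous extension [f (clamp t)]. *)
Lemma lipschitzian_on_ex_RInt (L : R) (f : R -> R) (p q : R) :
  p <= q -> lipschitzian_on L f p q -> ex_RInt f p q.
Proof.
  intros Hpq [HL Hf].
  apply (ex_RInt_ext (fun t => f (Rmax p (Rmin q t)))).
  (* Equality is required only for [p < t < q], where the clamp is the identity. *)
  { intros t. rewrite Rmin_left, Rmax_right by exact Hpq. intros Ht.
    rewrite (Rmin_right q t), (Rmax_right p t) by lra. reflexivity. }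
  apply (ex_RInt_continuous (V := R_CompleteNormedModule)).
  intros z _. apply continuity_pt_filterlim.
  intros eps Heps. exists (eps / L).
  split; [apply Rdiv_lt_0_compat; assumption |].
  intros t [_ Ht]. simpl in *. unfold Rdist in *.
  eapply Rle_lt_trans; [apply Hf; apply clamp_bounds; exact Hpq |].
  eapply Rle_lt_trans.
  { apply Rmult_le_compat_l; [lra | apply clamp_nonexpansive]. }
  replace eps with (L * (eps / L)) by (field; lra).
  apply Rmult_lt_compat_l; assumption.
Qed.

(** On [[p, q]] the graph of [f] lies between the two lines of slopes [L] and [- L] through either
    endpoint; integrating these lines gives both bounds. *)
Lemma lipschitzian_on_RInt_endpoints (L : R) (f : R -> R) (p q : R) :
  p <= q -> lipschitzian_on L f p q ->
  Rabs (f p * (q - p) - RInt f p q) <= L * (q - p) ^ 2 / 2 /\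
  Rabs (f q * (q - p) - RInt f p q) <= L * (q - p) ^ 2 / 2.
Proof.
  intros Hpq Hlip.
  assert (Hex := lipschitzian_on_ex_RInt L f p q Hpq Hlip).
  destruct Hlip as [HL Hf].
  assert (Hupper : forall c k z : R,
    (forall t, p < t < q -> f t <= c + k * (t - z)) ->
    RInt f p q <= c * (q - p) + k * ((q - z) ^ 2 - (p - z) ^ 2) / 2).
  { intros c k z Hle. rewrite <- (is_RInt_unique _ _ _ _ (is_RInt_affine c k z p q)).
    apply RInt_le; [exact Hpq | exact Hex | | exact Hle].
    eexists; apply is_RInt_affine. }
  assert (Hlower : forall c k z : R,
    (forall t, p < t < q -> c + k * (t - z) <= f t) ->
    c * (q - p) + k * ((q - z) ^ 2 - (p - z) ^ 2) / 2 <= RInt f p q).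
  { intros c k z Hle. rewrite <- (is_RInt_unique _ _ _ _ (is_RInt_affine c k z p q)).
    apply RInt_le; [exact Hpq | | exact Hex | exact Hle].
    eexists; apply is_RInt_affine. }
  assert (Hp : forall t, p < t < q -> - (L * (t - p)) <= f t - f p <= L * (t - p)).
  { intros t Ht. apply Rabs_le_between.
    rewrite <- (Rabs_pos_eq (t - p)) by lra. apply Hf; lra. }
  assert (Hq : forall t, p < t < q -> - (L * (q - t)) <= f q - f t <= L * (q - t)).
  { intros t Ht. apply Rabs_le_between.
    rewrite <- (Rabs_pos_eq (q - t)) by lra. apply Hf; lra. }
  (* The slopes trade places at [q] because [t - q] is negative. *)
  assert (H1 := Hupper (f p) L p). assert (H2 := Hlower (f p) (- L) p).
  assert (H3 := Hupper (f q) (- L) q). assert (H4 := Hlower (f q) L q).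
  split; apply Rabs_le_between; split.
  - enough (RInt f p q <= f p * (q - p) + L * ((q - p) ^ 2 - (p - p) ^ 2) / 2) by lra.
    apply H1. intros t Ht. specialize (Hp t Ht). lra.
  - enough (f p * (q - p) + - L * ((q - p) ^ 2 - (p - p) ^ 2) / 2 <= RInt f p q) by lra.
    apply H2. intros t Ht. specialize (Hp t Ht). lra.
  - enough (RInt f p q <= f q * (q - p) + - L * ((q - q) ^ 2 - (p - q) ^ 2) / 2) by lra.
    apply H3. intros t Ht. specialize (Hq t Ht). lra.
  - enough (f q * (q - p) + L * ((q - q) ^ 2 - (p - q) ^ 2) / 2 <= RInt f p q) by lra.
    apply H4. intros t Ht. specialize (Hq t Ht). lra.
Qed.

(* The tilted function [f t + L * t] is nondecreasing; its integral over [p, q]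
   is [RInt f p q + L * (q ^ 2 - p ^ 2) / 2]. *)
Lemma lipschitzian_on_tilt_endpoints (L M : R) (f : R -> R) (p q : R) :
  p <= q -> q - p <= M -> lipschitzian_on L f p q ->
  let I := RInt f p q + L * (q ^ 2 - p ^ 2) / 2 in
  let D := (f q + L * q) - (f p + L * p) in
  - (M * D) <= (f p + L * p) * (q - p) - I <= 0 /\
  0 <= (f q + L * q) * (q - p) - I <= M * D.
Proof.
  intros Hpq HM Hlip I D.
  (* Tilting shifts the error at [p] by [- L * (q - p) ^ 2 / 2] and the error at [q] by the opposite
     amount, which fixes their signs. The tilted errors differ by [(q - p) * D], whence the outer
     bounds. *)
  destruct (lipschitzian_on_RInt_endpoints L f p q Hpq Hlip) as [Hp Hq].
  apply Rabs_le_between in Hp. apply Rabs_le_between in Hq.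
  assert (HD : 0 <= D).
  { destruct Hlip as [HL Hf].
    assert (H := Hf q p ltac:(lra) ltac:(lra)).
    rewrite (Rabs_pos_eq (q - p)) in H by lra.
    apply Rabs_le_between in H. unfold D. lra. }
  assert (HMD : (q - p) * D <= M * D) by (apply Rmult_le_compat_r; assumption).
  unfold I, D in *. lra.
Qed.

Theorem theorem8 (a b L : R) (f : R -> R) (hab : a < b)
    (hf : lipschitzian_on L f a b) :
  let S := (f b - f a) / (b - a) in
  forall h x : R,
    0 <= h <= 1 ->
    a + h * ((b - a) / 2) <= x <= b - h * ((b - a) / 2) ->
    Rabs ((b - a) * (f x * (1 - h) + (f a + f b) / 2 * h) - RInt f a b)
      <= ((b - a) ^ 2 / 4 * (h ^ 2 + (h - 1) ^ 2) + (x - (a + b) / 2) ^ 2) * L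
    /\
    Rabs ((b - a) * ((f x + L * (x - (a + b) / 2)) * (1 - h)
                     + (f a + f b) / 2 * h) - RInt f a b)
      <= (b - a)
         * Rmax (h * ((b - a) / 2))
             (Rmax (x - a - h * ((b - a) / 2)) (b - x - h * ((b - a) / 2)))
         * (S + L).
Proof.
  intros S h x Hh Hx.
  assert (Hd : 0 <= h * ((b - a) / 2)) by (apply Rmult_le_pos; lra).
  pose (u := a + h * ((b - a) / 2)).
  pose (v := b - h * ((b - a) / 2)).
  assert (Hau : a <= u) by (unfold u; lra).
  assert (Hux : u <= x) by (unfold u; lra).
  assert (Hxv : x <= v) by (unfold v; lra).
  assert (Hvb : v <= b) by (unfold v; lra).
  assert (Lip : forall p q, a <= p -> q <= b -> lipschitzian_on L f p q)
    by (intros p q Hp Hq; exact (lipschitzian_on_sub L f a b p q Hp Hq hf)).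
  assert (Hex : forall p q, a <= p -> p <= q -> q <= b -> ex_RInt f p q)
    by (intros p q Hp Hpq Hq;
        exact (lipschitzian_on_ex_RInt L f p q Hpq (Lip p q Hp Hq))).
  assert (Hsplit : RInt f a b
    = RInt f a u + RInt f u x + (RInt f x v + RInt f v b)).
  { rewrite <- (RInt_Chasles f a x b), <- (RInt_Chasles f a u x),
      <- (RInt_Chasles f x v b) by (apply Hex; lra).
    reflexivity. }
  rewrite Hsplit. split.
  (* The lengths [x - u] and [v - x] are [(1 - h) * (b - a) / 2] plus and minus [x - (a + b) / 2],
     so the cross terms of their squares cancel. *)
  - destruct (lipschitzian_on_RInt_endpoints L f a u) as [H1 _]; [lra | apply Lip; lra |].
    destruct (lipschitzian_on_RInt_endpoints L f u x) as [_ H2]; [lra | apply Lip; lra |].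
    destruct (lipschitzian_on_RInt_endpoints L f x v) as [H3 _]; [lra | apply Lip; lra |].
    destruct (lipschitzian_on_RInt_endpoints L f v b) as [_ H4]; [lra | apply Lip; lra |].
    apply Rabs_le_between in H1. apply Rabs_le_between in H2.
    apply Rabs_le_between in H3. apply Rabs_le_between in H4.
    apply Rabs_le_between.
    set (I1 := RInt f a u) in *. set (I2 := RInt f u x) in *.
    set (I3 := RInt f x v) in *. set (I4 := RInt f v b) in *.
    clearbody I1 I2 I3 I4. unfold u, v in *. lra.
  - set (M := Rmax (h * ((b - a) / 2)) _).
    assert (HM1 : h * ((b - a) / 2) <= M) by apply Rmax_l.
    assert (HM2 : x - a - h * ((b - a) / 2) <= M)
      by (eapply Rle_trans; [apply Rmax_l | apply Rmax_r]).
    assert (HM3 : b - x - h * ((b - a) / 2) <= M)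
      by (eapply Rle_trans; [apply Rmax_r | apply Rmax_r]).
    destruct (lipschitzian_on_tilt_endpoints L M f a u) as [H1 _];
      [lra | unfold u; lra | apply Lip; lra |].
    destruct (lipschitzian_on_tilt_endpoints L M f u x) as [_ H2];
      [lra | unfold u; lra | apply Lip; lra |].
    destruct (lipschitzian_on_tilt_endpoints L M f x v) as [H3 _];
      [lra | unfold v; lra | apply Lip; lra |].
    destruct (lipschitzian_on_tilt_endpoints L M f v b) as [_ H4];
      [lra | unfold v; lra | apply Lip; lra |].
    (* [S + L] is the mean slope of the tilted function on [[a, b]]. *)
    replace ((b - a) * M * (S + L)) with (M * ((f b + L * b) - (f a + L * a)))
      by (unfold S; field; lra).
    apply Rabs_le_between.
    set (I1 := RInt f a u) in *. set (I2 := RInt f u x) in *.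
    set (I3 := RInt f x v) in *. set (I4 := RInt f v b) in *.
    set (fu := f u) in *. set (fv := f v) in *.
    (* The errors alternate in sign, so their sum is at most [M] times the total increment in
       absolute value. *)
    clearbody M I1 I2 I3 I4 fu fv. unfold u, v in *. lra.
Qed.
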